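(* Let $1\le k\le n$. The lexicographic Mayer-Vietoris tree corresponding to the consecutive $k$-out-of-$n$ system, i.e. the lexicographic Mayer-Vietoris tree of $$\bar I_{k,n}=\langle x_jx_{j+1}\cdots x_{j+k-1}\mid 1\leq j\leq n-k+1\rangle\subset\mathbf{k}[x_1,\dots,x_n],$$ has no repeated multidegrees in the relevant nodes; that is, no monomial is a minimal generator of two different relevant nodes.
   Context: $\mathbf{k}$ is a field of characteristic $0$. Mayer-Vietoris trees: a Mayer-Vietoris tree $MVT(I)$ of a nonzero monomial ideal $I$ is a rooted binary tree whose nodes are (labelled by) monomial ideals, with root $I$. Whenever a node $J$ has minimal monomial generating set $\{m_1,\dots,m_s\}$ with $s\geq 2$, one minimal generator (the pivot monomial) is chosen; numbering so that the pivot is $m_s$, the node $J$ has exactly two children: the left child $\tilde J=\langle m_1,\dots,m_{s-1}\rangle\cap\langle m_s\rangle=\langle \mathrm{lcm}(m_1,m_s),\dots,\mathrm{lcm}(m_{s-1},m_s)\rangle$ and the right child $J'=\langle m_1,\dots,m_{s-1}\rangle$. Nodes with a single minimal generator are leaves. Positions: the root has position $1$; left and right children of the node in position $p$ have positions $2p$ and $2p+1$. A node is relevant if its position is $1$ or even. In the lexicographic Mayer-Vietoris tree used here, the minimal generators of each node are listed in decreasing lexicographic order (with $x_1>x_2>\cdots>x_n$) and the pivot is always the last one in this list (so at the root the pivot is $x_{n-k+1}\cdots x_n$). *)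

(* Defs.v *)
From mathcomp Require Import all_boot all_order all_algebra.
From mathcomp Require Import mpoly.
Set Implicit Arguments. Unset Strict Implicit. Unset Printing Implicit Defensive.
Import GRing.Theory.
Local Open Scope ring_scope.

(* Ideals are taken as Prop-valued predicates, compared extensionally: [=idl]. *)
Definition same_ideal (F : fieldType) (n : nat)
    (I J : {mpoly F[n]} -> Prop) : Prop := forall f, I f <-> J f.

Notation "I =idl J" := (same_ideal I J) (at level 70, no associativity).

Definition mon_ideal (F : fieldType) (n : nat) (s : seq 'X_{1..n}) :
    {mpoly F[n]} -> Prop :=
  fun f => exists c : 'X_{1..n} -> {mpoly F[n]}, f = \sum_(m <- s) c m * 'X_[m].
Arguments mon_ideal F {n} s _.

Definition ideal_cap (F : fieldType) (n : nat)
    (I J : {mpoly F[n]} -> Prop) : {mpoly F[n]} -> Prop := fun f => I f /\ J f.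

(* [s] lists, without repetition, a monomial generating set of [I] no proper
   subset of which generates [I]. *)
Definition min_mon_gens (F : fieldType) (n : nat)
    (I : {mpoly F[n]} -> Prop) (s : seq 'X_{1..n}) : Prop :=
  [/\ uniq s, I =idl mon_ideal F s &
      forall t : seq 'X_{1..n}, {subset t <= s} -> I =idl mon_ideal F t ->
        {subset s <= t}].

Definition is_min_gen (F : fieldType) (n : nat)
    (I : {mpoly F[n]} -> Prop) (m : 'X_{1..n}) : Prop :=
  exists2 s : seq 'X_{1..n}, min_mon_gens I s & m \in s.

(* Pure lexicographic order with x_1 > x_2 > ... > x_n; the order that mpoly.v
   puts on 'X_{1..n} is graded, hence not usable here. *)
Definition mlex_gt (n : nat) (m1 m2 : 'X_{1..n}) : bool :=
  [exists i : 'I_n, (m2 i < m1 i)%N && [forall j : 'I_n, (j < i)%N ==> (m1 j == m2 j)]].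

(* [lexMVT I p J]: the lexicographic Mayer-Vietoris tree of [I] has a node in
   position [p], and it is labelled by [J].  In both child constructors
   [rcons s m] lists the minimal generators of [J], so [m] is the pivot;
   [s != [::]] says that [J] is not a leaf. *)
Inductive lexMVT (F : fieldType) (n : nat) (I : {mpoly F[n]} -> Prop) :
    nat -> ({mpoly F[n]} -> Prop) -> Prop :=
| lexMVT_root : lexMVT I 1 I
| lexMVT_left (p : nat) (J : {mpoly F[n]} -> Prop)
    (s : seq 'X_{1..n}) (m : 'X_{1..n}) :
    lexMVT I p J -> s != [::] ->
    min_mon_gens J (rcons s m) -> sorted (@mlex_gt n) (rcons s m) ->
    lexMVT I (2 * p) (ideal_cap (mon_ideal F s) (mon_ideal F [:: m]))
| lexMVT_right (p : nat) (J : {mpoly F[n]} -> Prop)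
    (s : seq 'X_{1..n}) (m : 'X_{1..n}) :
    lexMVT I p J -> s != [::] ->
    min_mon_gens J (rcons s m) -> sorted (@mlex_gt n) (rcons s m) ->
    lexMVT I (2 * p + 1) (mon_ideal F s).

Definition relevant (p : nat) : bool := (p == 1)%N || ~~ odd p.

(* With variables numbered from 0, this is x_j x_(j+1) ... x_(j+k-1). *)
Definition consec_mon (n k j : nat) : 'X_{1..n} :=
  [multinom (j <= i < j + k)%N : nat | i < n].

Definition consec_ideal (F : fieldType) (n k : nat) : {mpoly F[n]} -> Prop :=
  mon_ideal F [seq consec_mon n k j | j <- iota 0 (n - k + 1)].
Arguments consec_ideal F n k _ : clear implicits.

(* Main.v *)
Require Import Defs.
From mathcomp Require Import all_boot all_order all_algebra.
From mathcomp Require Import mpoly zify.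
Set Implicit Arguments.
Unset Strict Implicit.
Unset Printing Implicit Defensive.
Import GRing.Theory.

(** Variables are numbered from 0.  Write I(m) for the ideal generated by the
products of k consecutive variables among x_0, ..., x_(m-1), and u for the last
of these products, u = x_(m-k) ... x_(m-1).  The tree has only two kinds of
nodes, w I(m) and w (I(m) + (x_m)), where w is a monomial:
 - the pivot of w I(m) is w u; removing it leaves w I(m-1).  The lcm of u with
   the run starting at m-k-1 is x_(m-k-1) u, which divides the lcm of u with any
   other run overlapping or touching u; the runs inside x_0, ..., x_(m-k-2) are
   coprime to u.  So the left child is w u (I(m-k-1) + (x_(m-k-1)));
 - the pivot of w (I(m) + (x_m)) is w x_m, and x_m is coprime to the generators
   of I(m): the right child is w I(m) and the left one w x_m I(m).
[gens_pivot] and [step_left_gens] establish this, and [lexMVT_walk] transports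
it to the tree of ideals, because a minimal monomial generating set is
determined by the ideal and so is its lexicographic enumeration.

A monomial g generating a relevant node then determines the path from the root
to that node ([walk_gens_inj]).  Consider two paths that start at the same node
and lead to relevant nodes having g as a generator.
 - If one path is empty and the other is not, compare degrees: the generators at
   the start have degree at most deg w + k, those of a relevant proper
   descendant have a larger one ([mdeg_relevant]).
 - If the paths first go to different sides, compare exponents at the last
   variable of the pivot: below the right child it is the exponent in w
   ([walk_gens_eq]), below the left child it is larger, since every generator
   there is a multiple of the pivot ([walk_gens_ge]).
 - Otherwise, both go to the same child and one proceeds by induction. *)

(** * Monomial ideals and their minimal generators *)

(** The list must be free of repetitions since [mon_ideal] gives all copies of a
monomial the same coefficient, so that p copies of it cancel in characteristic p. *)
Lemma mon_idealP (F : fieldType) (n : nat) (s : seq 'X_{1..n})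
    (f : {mpoly F[n]}) : uniq s ->
  mon_ideal F s f <-> {in msupp f, forall m, exists2 d, d \in s & (d <= m)%MM}.
Proof.
move=> s_uniq; split=> [[c ->] m | supp_f].
  move/msupp_sum_le/flatten_mapP=> [d]; rewrite mem_filter /= => ds.
  rewrite (perm_mem (msuppMX _ _)) => /mapP[m' _ ->].
  by exists d => //; apply: lem_addr.
rewrite (mpolyE f) big_seq.
apply: (big_ind (fun g => mon_ideal F s g)) => [|g h [c ->] [d ->]|m mf].
- by exists (fun=> 0%R); rewrite big1 // => i _; rewrite mul0r.
- exists (fun e => c e + d e)%R; rewrite -big_split /=.
  by apply: eq_bigr => i _; rewrite mulrDl.
- have [d ds dm] := supp_f m mf.
  exists (fun e => if e == d then f@_m *: 'X_[m - d] else 0)%R.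
  rewrite (bigD1_seq d) //= eqxx big1 ?addr0 => [|e /negbTE->]; last first.
    by rewrite mul0r.
  by rewrite -scalerAl -mpolyXD submK.
Qed.

Lemma mem_mon_idealX (F : fieldType) (n : nat) (s : seq 'X_{1..n})
    (m : 'X_{1..n}) : uniq s ->
  mon_ideal F s 'X_[m] <-> exists2 d, d \in s & (d <= m)%MM.
Proof.
move=> s_uniq; rewrite mon_idealP // msuppX; split=> [|H e].
  by apply; rewrite mem_seq1.
by rewrite mem_seq1 => /eqP->.
Qed.

Definition antichain (n : nat) (s : seq 'X_{1..n}) : Prop :=
  {in s &, forall d e, (d <= e)%MM -> d = e}.

(** Each d in t is a multiple of some e in s, which is in turn a multiple of an
element of t; in an antichain that element is d, so e = d. Hence t is contained
in s, and minimality of s gives the equality. *)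
Lemma min_mon_gens_antichain (F : fieldType) (n : nat)
    (J : {mpoly F[n]} -> Prop) (s t : seq 'X_{1..n}) :
  uniq t -> antichain t -> J =idl mon_ideal F t -> min_mon_gens J s -> s =i t.
Proof.
move=> t_uniq t_anti Jt [s_uniq Js s_min].
have st f : mon_ideal F s f <-> mon_ideal F t f by rewrite -Js -Jt.
have sub_ts : {subset t <= s}.
  move=> g gt.
  have /st/(mem_mon_idealX _ _ s_uniq)[d ds dg] : mon_ideal F t 'X_[g].
    by apply/mem_mon_idealX => //; exists g; rewrite ?lepm_refl.
  have /st/(mem_mon_idealX _ _ t_uniq)[e et ed] : mon_ideal F s 'X_[d].
    by apply/mem_mon_idealX => //; exists d; rewrite ?lepm_refl.
  have eg : e = g by apply: t_anti => //; apply: lepm_trans ed dg.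
  have -> : g = d; last by [].
  apply/mnmP => i; apply/eqP; rewrite eqn_leq (mnm_lepP dg) andbT.
  by rewrite -[in g i]eg (mnm_lepP ed).
by move=> m; apply/idP/idP; [apply: s_min | apply: sub_ts].
Qed.

Lemma mlex_gt_irr (n : nat) : irreflexive (@mlex_gt n).
Proof. by move=> m; apply/existsP => -[i]; rewrite ltnn. Qed.

Lemma mlex_gtP (n : nat) (m1 m2 : 'X_{1..n}) :
  reflect (exists2 i : 'I_n, m2 i < m1 i & forall j : 'I_n, j < i -> m1 j = m2 j)
          (mlex_gt m1 m2).
Proof.
apply: (iffP existsP) => [[i /andP[lt_i /forallP eq_i]]|[i lt_i eq_i]].
  by exists i => // j ji; apply/eqP; have /implyP := eq_i j; apply.
exists i; rewrite lt_i; apply/forallP => j; apply/implyP => ji.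
by rewrite eq_i.
Qed.

Lemma mlex_gt_trans (n : nat) : transitive (@mlex_gt n).
Proof.
move=> m2 m1 m3 /mlex_gtP[i lt_i eq_i] /mlex_gtP[j lt_j eq_j].
apply/mlex_gtP; case: (ltngtP i j) => [ij|ji|/val_inj ij].
- exists i; first by rewrite -eq_j.
  by move=> l li; rewrite eq_i // eq_j // (ltn_trans li).
- exists j; first by rewrite eq_i.
  by move=> l lj; rewrite eq_i ?eq_j // (ltn_trans lj).
- subst j; exists i; first exact: ltn_trans lt_j lt_i.
  by move=> l li; rewrite eq_i ?eq_j.
Qed.

Lemma sorted_min_mon_gens (F : fieldType) (n : nat)
    (J : {mpoly F[n]} -> Prop) (s t : seq 'X_{1..n}) :
  antichain t -> sorted (@mlex_gt n) t -> J =idl mon_ideal F t ->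
  min_mon_gens J s -> sorted (@mlex_gt n) s -> s = t.
Proof.
move=> t_anti t_sorted Jt s_min s_sorted.
have t_uniq : uniq t := sorted_uniq (@mlex_gt_trans n) (@mlex_gt_irr n) t_sorted.
apply: (irr_sorted_eq (@mlex_gt_trans n) (@mlex_gt_irr n)) => //.
exact: min_mon_gens_antichain Jt s_min.
Qed.

(** * The nodes of the tree *)

(** [Node w m false] stands for w I(m), and [Node w m true] for
w (I(m) + (x_m)). *)
Record node (n : nat) := Node { cof : 'X_{1..n}; width : nat; extra : bool }.

(** There are m + 1 - k runs of k consecutive variables below x_m, and none when
m < k, where the truncated difference is 0. *)
Definition consec_gens (n k : nat) (w : 'X_{1..n}) (m : nat) : seq 'X_{1..n} :=
  [seq (w + consec_mon n k j)%MM | j <- iota 0 (m.+1 - k)].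

Definition gens (n k : nat) (v : node n) : seq 'X_{1..n} :=
  consec_gens k (cof v) (width v) ++
  (if extra v then [:: (cof v + consec_mon n 1 (width v))%MM] else [::]).

Definition pivot (n k : nat) (v : node n) : 'X_{1..n} :=
  (cof v + (if extra v then consec_mon n 1 (width v)
            else consec_mon n k (width v - k)))%MM.

(** The child of a node, the right one for [true]; a node has m + 1 - k
generators, and one more if it is extra, so it is a leaf exactly in the case
returning [None]. *)
Definition step (n k : nat) (v : node n) (b : bool) : option (node n) :=
  if width v + extra v <= k then None else Some
  (if b then Node (cof v) (width v - ~~ extra v) false
   else if extra v then Node (pivot k v) (width v) false
   else Node (pivot k v) (width v - k.+1) true).

Fixpoint walk (n k : nat) (v : node n) (path : seq bool) : option (node n) :=
  if path is b :: path' then obind (fun v' => walk k v' path') (step k v b)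
  else Some v.

Lemma walk_rcons (n k : nat) (v : node n) (path : seq bool) (b : bool) :
  walk k v (rcons path b) = obind (fun v' => step k v' b) (walk k v path).
Proof.
elim: path v => [|c path IH] v /=; first by case: step.
by case: step => //= v'; rewrite IH.
Qed.

Lemma consec_monE (n k j : nat) (i : 'I_n) :
  consec_mon n k j i = (j <= i < j + k) :> nat.
Proof. by rewrite mnmE. Qed.

Lemma mdeg_consec_mon (n k j : nat) : j + k <= n -> mdeg (consec_mon n k j) = k.
Proof.
move=> jkn; rewrite mdegE.
under eq_bigr do rewrite consec_monE.
rewrite -(big_mkord xpredT (fun i => nat_of_bool (j <= i < j + k))).
rewrite (@big_cat_nat _ _ _ j) ?(leq_trans (leq_addr k j)) //=.
rewrite (@big_cat_nat _ _ _ (j + k) j) ?leq_addr //=.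
rewrite big_nat big1 => [|i]; last by lia.
rewrite [X in (_ + (_ + X))%N]big_nat [X in (_ + (_ + X))%N]big1 => [|i]; last by lia.
rewrite (@eq_big_nat _ _ _ _ _ _ (fun=> 1)) => [|i]; last by lia.
by rewrite sum_nat_const_nat; lia.
Qed.

(** Every generator is the cofactor times a run of l variables from x_j on, with
l = k or, for the extra generator, l = 1. Treating both kinds alike reduces
questions of divisibility to linear arithmetic on l and j. *)
Definition block (n k : nat) (v : node n) (l j : nat) : bool :=
  ((l == k) && (j + k <= width v)) || [&& extra v, l == 1 & j == width v].

Lemma gensP (n k : nat) (v : node n) (g : 'X_{1..n}) : 0 < k ->
  reflect (exists l j, block k v l j /\ g = (cof v + consec_mon n l j)%MM)
          (g \in gens k v).
Proof.
move=> k_gt0; rewrite mem_cat; apply: (iffP orP) => [[]|].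
- move/mapP=> [j]; rewrite mem_iota => jP ->.
  by exists k, j; split=> //; rewrite /block; lia.
- case Ev: (extra v) => //; rewrite mem_seq1 => /eqP->.
  by exists 1, (width v); split=> //; rewrite /block Ev !eqxx orbT.
- case=> l [j [/orP[/andP[/eqP-> jP]|/and3P[-> /eqP-> /eqP->]] ->]].
    by left; apply/mapP; exists j => //; rewrite mem_iota; lia.
  by right; rewrite mem_seq1.
Qed.

Lemma consec_mon_le (n l j l' j' : nat) : 0 < l -> j + l <= n ->
  (consec_mon n l j <= consec_mon n l' j')%MM -> j' <= j /\ j + l <= j' + l'.
Proof.
move=> l_gt0 jln /mnm_lepP le.
have lt1 : j < n by lia.
have lt2 : (j + l).-1 < n by lia.
have := le (Ordinal lt1); have := le (Ordinal lt2); rewrite !consec_monE /=; lia.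
Qed.

Lemma gens_antichain (n k : nat) (v : node n) : 0 < k ->
  width v + extra v <= n -> antichain (gens k v).
Proof.
move=> k_gt0 vn d e /(gensP _ _ k_gt0)[l [j [B ->]]].
move=> /(gensP _ _ k_gt0)[l' [j' [B' ->]]] le.
have {}le : (consec_mon n l j <= consec_mon n l' j')%MM.
  by apply/mnm_lepP => i; move/mnm_lepP/(_ i): le; rewrite !mnmDE leq_add2l.
have [] := consec_mon_le _ _ le; move: B B'; rewrite /block; try lia.
move=> B B' ? ?; have [-> ->] : l = l' /\ j = j' by lia.
by [].
Qed.

Lemma mlex_gt_consec (n l j l' j' : nat) (w : 'X_{1..n}) :
  j < j' -> j < n -> 0 < l ->
  mlex_gt (w + consec_mon n l j)%MM (w + consec_mon n l' j')%MM.
Proof.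
move=> jj' jn l_gt0; apply/mlex_gtP; exists (Ordinal jn) => [|i] /=.
  by rewrite !mnmDE !consec_monE /=; lia.
by move=> ij; rewrite !mnmDE !consec_monE; lia.
Qed.

Lemma gens_sorted (n k : nat) (v : node n) : 0 < k ->
  width v + extra v <= n -> sorted (@mlex_gt n) (gens k v).
Proof.
move=> k_gt0 vn; apply: pairwise_sorted; rewrite pairwise_cat.
apply/and3P; split; last by case: extra.
- apply/allrelP => _ e /mapP[j + ->]; rewrite mem_iota => jP.
  case: (extra v) => //; rewrite mem_seq1 => /eqP->.
  by apply: mlex_gt_consec => //; lia.
- rewrite pairwise_map; apply: (@sub_in_pairwise _ (mem (iota 0 ((width v).+1 - k))) ltn).
  + move=> i j /=; rewrite !mem_iota => iP jP ij.
    by apply: mlex_gt_consec => //; lia.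
  + by apply/allP.
  + by rewrite -(sorted_pairwise ltn_trans) iota_ltn_sorted.
Qed.

Lemma gens_uniq (n k : nat) (v : node n) : 0 < k ->
  width v + extra v <= n -> uniq (gens k v).
Proof.
move=> k_gt0 vn.
exact: sorted_uniq (@mlex_gt_trans n) (@mlex_gt_irr n) _ (gens_sorted k_gt0 vn).
Qed.

Lemma gens_pivot (n k : nat) (v r : node n) : step k v true = Some r ->
  gens k v = rcons (gens k r) (pivot k v).
Proof.
rewrite /step; case: ifP => // lt_k [<-]; rewrite /gens /pivot /= cats0.
case: v lt_k => w m [] /= lt_k; first by rewrite subn0 cats1.
rewrite cats0 /consec_gens -map_rcons; congr (map _ _).
rewrite (_ : m.+1 - k = ((m - 1).+1 - k) + 1); last by lia.
by rewrite iotaD cats1; congr rcons; lia.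
Qed.

(** Both sides say that f is a multiple of an lcm of the pivot with another
generator; on the left these lcms are reduced to the minimal ones. *)
Lemma step_left_gens (n k : nat) (v r u : node n) (f : 'X_{1..n}) : 0 < k ->
  width v + extra v <= n ->
  step k v true = Some r -> step k v false = Some u ->
  (exists2 d, d \in gens k u & (d <= f)%MM) <->
  (exists2 d, d \in gens k r & (d <= f)%MM) /\ (pivot k v <= f)%MM.
Proof.
move=> k_gt0; rewrite /step; case: ifP => // lt_k vn [<-] [<-].
case: v lt_k vn => w m [] /= lt_k vn; split.
- case=> _ /(gensP _ _ k_gt0)[l [j [B ->]]] /mnm_lepP le; split.
    exists (w + consec_mon n l j)%MM.
      apply/gensP => //; exists l, j; split=> //; move: B; rewrite /block /=; lia.
    by apply/mnm_lepP => i; have := le i; rewrite /pivot /= !mnmDE; lia.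
  by apply/mnm_lepP => i; have := le i; rewrite /pivot /= !mnmDE; lia.
- case=> -[_ /(gensP _ _ k_gt0)[l [j [B ->]]] /mnm_lepP le1 /mnm_lepP le2].
  exists (pivot k (Node w m true) + consec_mon n l j)%MM.
    apply/gensP => //; exists l, j; split=> //; move: B; rewrite /block /=; lia.
  apply/mnm_lepP => i; move: B (le1 i) (le2 i).
  by rewrite /pivot /block /= !mnmDE !consec_monE; lia.
- case=> _ /(gensP _ _ k_gt0)[l [j [B ->]]] /mnm_lepP le; split.
    exists (w + consec_mon n k j)%MM.
      apply/gensP => //; exists k, j; split=> //; move: B; rewrite /block /=; lia.
    apply/mnm_lepP => i; have := le i; move: B.
    by rewrite /block /pivot /= !mnmDE !consec_monE; lia.
  by apply/mnm_lepP => i; have := le i; rewrite /pivot /= !mnmDE; lia.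
- case=> -[_ /(gensP _ _ k_gt0)[l [j [B ->]]] /mnm_lepP le1 /mnm_lepP le2].
  (* Either the run from j on ends before x_(m-k-1), or it contains it. *)
  have [jP|jP] := leqP (j + k) (m - k.+1).
  + exists (pivot k (Node w m false) + consec_mon n k j)%MM.
      by apply/gensP => //; exists k, j; split=> //; rewrite /block /=; lia.
    apply/mnm_lepP => i; move: B (le1 i) (le2 i).
    by rewrite /pivot /block /= !mnmDE !consec_monE; lia.
  + exists (pivot k (Node w m false) + consec_mon n 1 (m - k.+1))%MM.
      by apply/gensP => //; exists 1, (m - k.+1); split=> //; rewrite /block /=; lia.
    apply/mnm_lepP => i; move: B (le1 i) (le2 i).
    by rewrite /pivot /block /= !mnmDE !consec_monE; lia.
Qed.

Lemma step_fits (n k : nat) (v u : node n) (b : bool) :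
  width v + extra v <= n -> step k v b = Some u -> width u + extra u <= n.
Proof.
rewrite /step; case: ifP => // lt_k vn [<-].
by case: b; case: v lt_k vn => w m [] /= lt_k vn; lia.
Qed.

Lemma walk_fits (n k : nat) (v u : node n) (path : seq bool) :
  width v + extra v <= n -> walk k v path = Some u -> width u + extra u <= n.
Proof.
elim: path v => [v vn [<-] //|b path IH v vn] /=.
by case E: step => [v'|] //=; apply: IH; apply: step_fits E.
Qed.

Lemma step_defined (n k : nat) (v : node n) (b : bool) :
  1 < size (gens k v) -> exists u, step k v b = Some u.
Proof.
rewrite /step size_cat size_map size_iota => gt1; case: ifP; last by eexists.
by move: gt1; case: extra => /=; lia.
Qed.

(** * From the tree of ideals to paths *)

Definition root_node (n : nat) : node n := Node 0%MM n false.

Definition position (path : seq bool) : nat :=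
  foldl (fun p b => 2 * p + nat_of_bool b) 1 path.

Lemma position_rcons (path : seq bool) (b : bool) :
  position (rcons path b) = 2 * position path + b.
Proof. by rewrite /position -cats1 foldl_cat. Qed.

Lemma lexMVT_walk (F : fieldType) (n k : nat) (p : nat)
    (J : {mpoly F[n]} -> Prop) :
  0 < k -> k <= n -> lexMVT (consec_ideal F n k) p J ->
  exists path u, [/\ p = position path, walk k (root_node n) path = Some u
                   & J =idl mon_ideal F (gens k u)].
Proof.
move=> k_gt0 kn; elim=> {p J} [|p J s m _ [path [u [-> wu Ju]]] s_nil|
                              p J s m _ [path [u [-> wu Ju]]] s_nil].
- exists [::], (root_node n); split=> // f; rewrite /consec_ideal /gens cats0.
  rewrite /consec_gens /= (_ : n - k + 1 = n.+1 - k); last by lia.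
  by under [in X in _ <-> X]eq_map do rewrite add0m.
all: have un : width u + extra u <= n by apply: walk_fits wu; rewrite /= addn0.
all: move=> s_min s_sorted.
all: have Es := sorted_min_mon_gens (gens_antichain k_gt0 un)
                  (gens_sorted k_gt0 un) Ju s_min s_sorted.
all: have u_size : 1 < size (gens k u) by rewrite -Es size_rcons; case: (s) s_nil.
all: have [r Er] := step_defined true u_size.
all: move: (Es); rewrite (gens_pivot Er) => /rcons_inj[? ?]; subst s m.
- have [l El] := step_defined false u_size.
  exists (rcons path false), l; rewrite position_rcons walk_rcons wu addn0.
  split=> // f.
  rewrite /ideal_cap !mon_idealP ?(gens_uniq k_gt0) ?(step_fits un Er) ?(step_fits un El) //.
  have cap_gens v := step_left_gens v k_gt0 un Er El.
  split=> [[H1 H2] v vf|H].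
    apply/cap_gens; split; first exact: H1.
    by have [d] := H2 v vf; rewrite mem_seq1 => /eqP->.
  split=> v /H /cap_gens[] // _ le; by exists (pivot k u); rewrite ?mem_seq1.
- exists (rcons path true), r; rewrite position_rcons walk_rcons wu.
  by split.
Qed.

(** * Reading the path off a generator *)

Lemma step_cof (n k : nat) (v u : node n) (b : bool) : step k v b = Some u ->
  exists e, cof u = (cof v + e)%MM.
Proof.
rewrite /step; case: ifP => // _ [<-].
case: b; first by exists 0%MM; rewrite addmC add0m.
by case: extra; eexists.
Qed.

Lemma step_cof_eq (n k : nat) (v u : node n) (b : bool) : step k v b = Some u ->
  width u + extra u <= width v + extra v /\
  forall i : 'I_n, width v + extra v <= i -> cof u i = cof v i.
Proof.
rewrite /step; case: ifP => // lt_k [<-].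
by case: b; case: v lt_k => w m [] /= lt_k; (split; first lia) => i im;
  rewrite // /pivot mnmDE consec_monE /=; lia.
Qed.

Lemma walk_gens_eq (n k : nat) (v u : node n) (path : seq bool)
    (g : 'X_{1..n}) (i : 'I_n) : 0 < k ->
  walk k v path = Some u -> g \in gens k u -> width v + extra v <= i ->
  g i = cof v i.
Proof.
move=> k_gt0; elim: path v => [v [->] /(gensP _ _ k_gt0)[l [j [B ->]]] im|b path IH v] /=.
  by move: B; rewrite /block mnmDE consec_monE; lia.
case E: step => [v'|] //= wu gu im; have [le eq] := step_cof_eq E.
by rewrite (IH v') ?eq //; lia.
Qed.

Lemma walk_gens_ge (n k : nat) (v u : node n) (path : seq bool)
    (g : 'X_{1..n}) : 0 < k ->
  walk k v path = Some u -> g \in gens k u -> (cof v <= g)%MM.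
Proof.
move=> k_gt0; elim: path v => [v [->] /(gensP _ _ k_gt0)[l [j [B ->]]]|b path IH v] /=.
  exact: lem_addr.
case E: step => [v'|] //= wu gu; apply: lepm_trans (IH _ wu gu).
by have [e ->] := step_cof E; apply: lem_addr.
Qed.

Lemma mdeg_gens (n k : nat) (v : node n) (g : 'X_{1..n}) : 0 < k ->
  width v + extra v <= n -> g \in gens k v ->
  mdeg (cof v) < mdeg g <= mdeg (cof v) + k /\
  (~~ extra v -> mdeg g = mdeg (cof v) + k).
Proof.
move=> k_gt0 vn /(gensP _ _ k_gt0)[l [j [B ->]]].
by rewrite mdegD mdeg_consec_mon; move: B; rewrite /block; lia.
Qed.

(** Let w be the cofactor of v. The last step of the path goes to a left child.
From a node w' I(m) it multiplies the cofactor by k variables, and a generator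
adds at least one more; from w' (I(m) + (x_m)) it multiplies the cofactor by
x_m, and all generators add k variables. Earlier steps only enlarge w. *)
Lemma mdeg_relevant (n k : nat) (v u : node n) (b : bool) (path : seq bool)
    (g : 'X_{1..n}) : 0 < k -> width v + extra v <= n ->
  walk k v (b :: path) = Some u -> ~~ last b path -> g \in gens k u ->
  mdeg (cof v) + k < mdeg g.
Proof.
move=> k_gt0; elim: path v b => [|c path IH] v b vn.
  rewrite /=; case E: step => [v'|] //= [<-]; case: b E => // E _ gv'.
  have := mdeg_gens k_gt0 (step_fits vn E) gv'.
  move: vn E; rewrite /step; case: ifP => // lt_k vn [<-].
  by case: v lt_k vn => w m [] /= lt_k vn; rewrite /pivot mdegD /=;
    rewrite mdeg_consec_mon //; lia.
rewrite [walk _ _ _]/=; case E: (step k v b) => [v'|] // wu lst gu.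
apply: leq_ltn_trans (IH v' c (step_fits vn E) wu lst gu).
by have [e ->] := step_cof E; rewrite mdegD leq_add2r leq_addr.
Qed.

(** Starting the [last] at [false] makes the empty path count as relevant, like
the root, while a path ending with a right step is not. *)
Lemma walk_gens_inj (n k : nat) (v u1 u2 : node n) (path1 path2 : seq bool)
    (g : 'X_{1..n}) : 0 < k -> width v + extra v <= n ->
  walk k v path1 = Some u1 -> walk k v path2 = Some u2 ->
  ~~ last false path1 -> ~~ last false path2 ->
  g \in gens k u1 -> g \in gens k u2 -> path1 = path2.
Proof.
move=> k_gt0.
have nil_cons v' u b path : width v' + extra v' <= n ->
    walk k v' (b :: path) = Some u -> ~~ last b path ->
    g \in gens k v' -> g \in gens k u -> False.
  move=> vn wu lst /(mdeg_gens k_gt0 vn)[/andP[_ le] _].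
  by move/(mdeg_relevant k_gt0 vn wu lst); rewrite ltnNge le.
have left_right (v' ul ur : node n) pl pr : width v' + extra v' <= n ->
    walk k v' (false :: pl) = Some ul -> walk k v' (true :: pr) = Some ur ->
    g \in gens k ul -> g \in gens k ur -> False.
  rewrite /=; case El: (step k v' false) => [l|] //=.
  case Er: (step k v' true) => [r|] //= vn wl wr gl gr.
  (* The last variable of the pivot: x_(m-1) for w I(m), x_m for
     w (I(m) + (x_m)). *)
  have last_lt : (width v' + extra v').-1 < n.
    by move: El vn; rewrite /step; case: ifP => //; lia.
  have := walk_gens_eq (i := Ordinal last_lt) k_gt0 wr gr.
  have /mnm_lepP/(_ (Ordinal last_lt)) := walk_gens_ge k_gt0 wl gl.
  move: El Er wl wr; rewrite /step; case: ifP => // lt_k [<-] [<-] _ _.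
  case: v' vn last_lt lt_k => w m [] /= vn last_lt lt_k; rewrite /pivot mnmDE consec_monE /=; lia.
elim: path1 path2 v => [|b1 path1 IH] [|b2 path2] v vn //.
- by move=> [<-] w2 _ l2 g1 g2; case: (nil_cons _ _ _ _ vn w2 l2 g1 g2).
- by move=> w1 [<-] l1 _ g1 g2; case: (nil_cons _ _ _ _ vn w1 l1 g2 g1).
have [<-{b2}|neq_b] := eqVneq b1 b2.
  rewrite /=; case E: step => [v'|] //= w1 w2 l1 l2 g1 g2; congr cons.
  have lastN path : ~~ last b1 path -> ~~ last false path by case: path.
  by apply: (IH path2 v') => //; [apply: step_fits E|apply: lastN|apply: lastN].
case: b1 b2 neq_b => -[] // _ w1 w2 _ _ g1 g2.
- by case: (left_right _ _ _ _ _ vn w2 w1 g2 g1).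
- by case: (left_right _ _ _ _ _ vn w1 w2 g1 g2).
Qed.

Lemma relevant_position (path : seq bool) :
  relevant (position path) -> ~~ last false path.
Proof.
have pos_gt0 (s : seq bool) : 0 < position s.
  by elim/last_ind: s => // s b IH; rewrite position_rcons; lia.
case/lastP: path => // path b; rewrite last_rcons position_rcons /relevant.
by case: b => //; have := pos_gt0 path; lia.
Qed.

Local Open Scope ring_scope.

Theorem proposition4p3p19 (F : fieldType) (charF0 : [pchar F] =i pred0)
    (n k : nat) (hk : (1 <= k)%N) (hkn : (k <= n)%N)
    (p q : nat) (J K : {mpoly F[n]} -> Prop)
    (hJ : lexMVT (consec_ideal F n k) p J)
    (hK : lexMVT (consec_ideal F n k) q K)
    (hp : relevant p) (hq : relevant q) (hpq : p <> q) :
  ~ exists m : 'X_{1..n}, is_min_gen J m /\ is_min_gen K m.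
Proof.
have root_fits : (width (root_node n) + extra (root_node n) <= n)%N.
  by rewrite /= addn0.
have walk_gen path u L m : walk k (root_node n) path = Some u ->
    L =idl mon_ideal F (gens k u) -> is_min_gen L m -> m \in gens k u.
  move=> wu Lu [s s_min ms]; have un := walk_fits root_fits wu.
  by rewrite -(min_mon_gens_antichain (gens_uniq hk un) (gens_antichain hk un) Lu s_min).
have [path1 [u1 [p_pos walk1 J_gens]]] := lexMVT_walk hk hkn hJ.
have [path2 [u2 [q_pos walk2 K_gens]]] := lexMVT_walk hk hkn hK.
case=> m [/(walk_gen _ _ _ _ walk1 J_gens) m1 /(walk_gen _ _ _ _ walk2 K_gens) m2].
apply: hpq; rewrite p_pos q_pos; congr position.
apply: (walk_gens_inj hk root_fits walk1 walk2 _ _ m1 m2).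
  by apply: relevant_position; rewrite -p_pos.
by apply: relevant_position; rewrite -q_pos.
Qed.
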